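(* Let $0<\zeta<\hat\zeta<1$. The iterative refinement method described in the context (called IR-IF-IPM when the limited-precision solver is IF-IPM, and IR-IF-QIPM when it is IF-QIPM) produces a $\zeta$-optimal solution of the linear optimization problem $(A,b,c)$ with at most $$O\!\left(\frac{\log\log(1/\zeta)}{\log\log(1/\hat\zeta)}\right)$$ calls to IF-IPM (respectively IF-QIPM) with precision $\hat\zeta$.
   Context: Let $A\in\mathbb R^{m\times n}$ have rank $m$, $b\in\mathbb R^m$, $c\in\mathbb R^n$. The linear optimization problem $(A,b,c)$ is the primal-dual pair $\min c^Tx$ s.t. $Ax=b$, $x\ge0$; and $\max b^Ty$ s.t. $A^Ty+s=c$, $s\ge0$. For $\zeta\ge0$, a primal-dual feasible $(x,y,s)$ is $\zeta$-optimal if $x^Ts/n\le\zeta$; the set of these is $\mathcal{PD}_\zeta$. It is assumed that a feasible interior solution $(x^0,y^0,s^0)$ (feasible with $x^0,s^0>0$) is available. For $\theta\in[0,1)$, $\mathcal N(\theta)$ is the set of feasible interior $(x,y,s)$ with $\|XSe-\mu e\|_2\le\theta\mu$, where $\mu=x^Ts/n$, $X=\mathrm{diag}(x)$, $S=\mathrm{diag}(s)$, and $e$ is the all-one vector. IF-IPM with precision $\hat\zeta$ (short-step inexact feasible interior point method): let $A=[A_B\ A_N]$ with $A_B$ nonsingular (after column reordering) and let $V=\begin{bmatrix}A_B^{-1}A_N\\-I\end{bmatrix}$. Set $\eta=0.1$, $\theta=0.2$, $\beta=1-0.11/\sqrt n$ and start from a feasible interior point in $\mathcal N(\theta)$. While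 the current iterate $(x,y,s)\notin\mathcal{PD}_{\hat\zeta}$: put $\mu=x^Ts/n$; solve the linear system $-XA^T\Delta y+SV\lambda=\beta\mu e-Xs$ for $(\lambda,\Delta y)$ inexactly, with error at most $\eta\mu/\|M\|_2$, where $M=[-XA^T\ \ SV]$ (so the residual norm is at most $\eta\mu$); set $\Delta x=V\lambda$, $\Delta s=-A^T\Delta y$; and replace $(x,y,s)$ by $(x+\Delta x,y+\Delta y,s+\Delta s)$. The last iterate is returned, so the output is $\hat\zeta$-optimal for the problem solved. IF-QIPM with precision $\hat\zeta$: the same method, with $\theta=0.3$, in which the linear system is solved by a quantum linear system algorithm combined with quantum tomography, with residual norm at most $\eta\mu$. Refining problem: for a feasible $(x,y,s)$ and scaling factor $\nabla>1$, it is the primal-dual pair $\min \nabla s^T\hat x$ s.t. $A\hat x=0$, $\hat x\ge-\nabla x$; and $\max -\nabla x^T\hat s$ s.t. $A^T\hat y+\hat s=\nabla s$, $\hat s\ge0$. The change of variables $\hat x'=\hat x+\nabla x$ puts it in standard form (with right-hand side $\nabla b$), and IF-IPM or IF-QIPM is applied to it through this form; a feasible $(\hat x,\hat y,\hat s)$ is $\hat\zeta$-optimal for it if $(\hat x+\nabla x)^T\hat s/n\le\hat\zeta$. Iterative refinement method (input $A,b,c$ and $\zeta<\hat\zeta<1$): (1) Solve $(A,b,c)$ by IF-IPM (or IF-QIPM) with precision $\hat\zeta$ to obtain $(x^1,y^1,s^1)$; set $k=1$. (2) While $(x^k,y^k,s^k)\notin\mathcal{PD}_\zeta$: set $\nabla^k=1/((x^k)^Ts^k)$;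 solve by IF-IPM (or IF-QIPM) with precision $\hat\zeta$ the refining problem defined by $(x^k,y^k,s^k)$ and $\nabla^k$ to obtain $(\hat x^k,\hat y^k,\hat s^k)$; set $x^{k+1}=x^k+\frac1{\nabla^k}\hat x^k$, $y^{k+1}=y^k+\frac1{\nabla^k}\hat y^k$, $s^{k+1}=c-A^Ty^{k+1}$; and increase $k$ by one.
   Formalization: Proved for nζ̂ < 1 (otherwise the method can stall forever) and ζ̂ ≠ 1/e; the O-constant depends on ζ̂ (no uniform one exists); the bound is max(1, |quotient|), which equals the quotient for ζ̂ < 1/e. *)

(* Defs.v *)
From HB Require Import structures.
From mathcomp Require Import all_boot all_order all_algebra.
From mathcomp Require Import all_classical all_reals all_analysis.

Set Implicit Arguments.
Unset Strict Implicit.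
Unset Printing Implicit Defensive.

Import Order.TTheory GRing.Theory Num.Theory.

Local Open Scope ring_scope.

(* The norm [`|v|] of MathComp-Analysis on matrices is the maximum norm, hence
   these Euclidean and spectral norms. *)
Definition norm2 (R : realType) (n : nat) (v : 'cV[R]_n) : R :=
  Num.sqrt (\sum_i v i 0 ^+ 2).

Definition opnorm2 (R : realType) (m n : nat) (M : 'M[R]_(m, n)) : R :=
  sup [set r | exists2 v : 'cV[R]_n, norm2 v <= 1 & r = norm2 (M *m v)]%classic.

Record lo_problem (R : realType) (m n : nat) :=
  Lo { lo_A : 'M[R]_(m, n); lo_b : 'cV[R]_m; lo_c : 'cV[R]_n }.

Record pdpoint (R : realType) (m n : nat) :=
  Point { px : 'cV[R]_n; py : 'cV[R]_m; ps : 'cV[R]_n }.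

Section LinearOptimization.
Variables (R : realType) (m n : nat).
Implicit Types (P : lo_problem R m n) (z : pdpoint R m n).

Definition gap z : R := ((px z)^T *m ps z) 0 0.

Definition mu z : R := gap z / n%:R.

Definition eq_feasible P z :=
  lo_A P *m px z = lo_b P /\ (lo_A P)^T *m py z + ps z = lo_c P.

Definition feasible P z :=
  [/\ eq_feasible P z, forall i, 0 <= px z i 0 & forall i, 0 <= ps z i 0].

Definition interior_feasible P z :=
  [/\ eq_feasible P z, forall i, 0 < px z i 0 & forall i, 0 < ps z i 0].

Definition optimal P (zeta : R) z := feasible P z /\ mu z <= zeta.

Definition Xmx z : 'M[R]_n := diag_mx (px z)^T.
Definition Smx z : 'M[R]_n := diag_mx (ps z)^T.
Definition e1 : 'cV[R]_n := const_mx 1.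

Definition nbhd (theta : R) P z :=
  interior_feasible P z /\ norm2 (Xmx z *m Smx z *m e1 - mu z *: e1) <= theta * mu z.

(* [f] and [g] list the indices of the columns in [A_B] and [A_N]. The rows of
   [V] are kept in the original order of the variables: those listed by [f]
   form [A_B^-1 A_N], those listed by [g] form [-I]. *)
Definition null_basis (A : 'M[R]_(m, n)) (V : 'M[R]_(n, n - m)) :=
  exists (f : 'I_m -> 'I_n) (g : 'I_(n - m) -> 'I_n),
  [/\ bijective (fun u : 'I_m + 'I_(n - m) =>
                   match u with inl i => f i | inr j => g j end),
      colsub f A \in unitmx,
      rowsub f V = invmx (colsub f A) *m colsub g A
    & rowsub g V = - 1%:M].

End LinearOptimization.

Inductive solver := IF_IPM | IF_QIPM.

Section InteriorPointMethod.
Variables (R : realType) (m n : nat).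
Implicit Types (P : lo_problem R m n) (z : pdpoint R m n) (sol : solver).

Definition eta : R := 1 / 10%:R.

Definition theta sol : R :=
  match sol with IF_IPM => 2%:R / 10%:R | IF_QIPM => 3%:R / 10%:R end.

Definition beta : R := 1 - (11%:R / 100%:R) / Num.sqrt n%:R.

(* The unknown is [col_mx dy lambda]. *)
Definition newton_mx P (V : 'M[R]_(n, n - m)) z : 'M[R]_(n, m + (n - m)) :=
  row_mx (- (Xmx z *m (lo_A P)^T)) (Smx z *m V).

Definition newton_rhs z : 'cV[R]_n := (beta * mu z) *: e1 R n - Xmx z *m ps z.

(* The quantum linear system algorithm and the tomography enter only through
   the accuracy that they guarantee for the computed solution. *)
Definition inexact_solution sol (p : nat) (M : 'M[R]_(n, p)) (r : 'cV[R]_n)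
    (tol : R) (w : 'cV[R]_p) :=
  match sol with
  | IF_IPM =>
      exists2 w0 : 'cV[R]_p, M *m w0 = r & norm2 (w - w0) <= tol / opnorm2 M
  | IF_QIPM => norm2 (M *m w - r) <= tol
  end.

Definition ipm_step sol P V z z' :=
  exists (lambda : 'cV[R]_(n - m)) (dy : 'cV[R]_m),
    inexact_solution sol (newton_mx P V z) (newton_rhs z) (eta * mu z)
                     (col_mx dy lambda)
    /\ z' = Point (px z + V *m lambda) (py z + dy) (ps z - (lo_A P)^T *m dy).

Inductive ipm_run sol P V (zeta : R) : pdpoint R m n -> pdpoint R m n -> Prop :=
| Ipm_stop z of optimal P zeta z : ipm_run sol P V zeta z z
| Ipm_step z z' z'' of ~ optimal P zeta z & ipm_step sol P V z z' &
    ipm_run sol P V zeta z' z'' : ipm_run sol P V zeta z z''.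

(* Whatever the errors made in solving the linear systems, the method started
   at the given point is never stuck and stops after finitely many steps. *)
Inductive ipm_terminates sol P V (zeta : R) : pdpoint R m n -> Prop :=
| Ipm_halt z of optimal P zeta z : ipm_terminates sol P V zeta z
| Ipm_continue z of (exists z', ipm_step sol P V z z') &
    (forall z', ipm_step sol P V z z' -> ipm_terminates sol P V zeta z') :
    ipm_terminates sol P V zeta z.

Definition ipm_input sol P V z0 :=
  null_basis (lo_A P) V /\ nbhd (theta sol) P z0.

Definition call_output sol P (zeta : R) z :=
  exists V z0, ipm_input sol P V z0 /\ ipm_run sol P V zeta z0 z.

Definition call_succeeds sol P (zeta : R) :=
  (exists V z0, ipm_input sol P V z0) /\
  forall V z0, ipm_input sol P V z0 -> ipm_terminates sol P V zeta z0.

End InteriorPointMethod.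

Section IterativeRefinement.
Variables (R : realType) (m n : nat).
Implicit Types (P : lo_problem R m n) (z : pdpoint R m n) (sol : solver).

Definition nabla z : R := (gap z)^-1.

(* The refining problem [min (a s)^T x^] subject to [A x^ = 0, x^ >= - a x], in
   the standard form given by the change of variables [x^' = x^ + a x]; the
   constant [- (a s)^T (a x)] in the objective is dropped. *)
Definition refining P z (a : R) : lo_problem R m n :=
  Lo (lo_A P) (a *: lo_b P) (a *: ps z).

(* [zh] solves the standard form of the refining problem, so that
   [px zh - a *: px z] is the correction [x^] of the primal variables. *)
Definition refine P z (a : R) (zh : pdpoint R m n) : pdpoint R m n :=
  let x := px z + a^-1 *: (px zh - a *: px z) in
  let y := py z + a^-1 *: py zh in
  Point x y (lo_c P - (lo_A P)^T *m y).

(* [ir_iterate sol P zeta zetahat k z]: some run of the method with target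
   precision [zeta] has [z] as its [k]-th iterate; the run has then made
   exactly [k] calls to [sol] with precision [zetahat]. *)
Inductive ir_iterate sol P (zeta zetahat : R) : nat -> pdpoint R m n -> Prop :=
| Ir_first z of call_output sol P zetahat z :
    ir_iterate sol P zeta zetahat 1 z
| Ir_next k z zh of ir_iterate sol P zeta zetahat k z & ~ optimal P zeta z &
    call_output sol (refining P z (nabla z)) zetahat zh :
    ir_iterate sol P zeta zetahat k.+1 (refine P z (nabla z) zh).

(* Every call is well posed and terminates, every run makes at most [N] calls,
   and a run stops only at a [zeta]-optimal solution, which is reached. *)
Definition ir_produces_optimal sol P (zeta zetahat N : R) :=
  [/\ call_succeeds sol P zetahat,
      forall k z, ir_iterate sol P zeta zetahat k z -> ~ optimal P zeta z ->
        [/\ feasible P z, 1 < nabla z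
          & call_succeeds sol (refining P z (nabla z)) zetahat],
      forall k z, ir_iterate sol P zeta zetahat k z -> k%:R <= N
    & exists k z, ir_iterate sol P zeta zetahat k z /\ optimal P zeta z].

End IterativeRefinement.

(* For [zetahat < 1/e] both iterated logarithms are positive and the quotient
   exceeds [1], so that the absolute value and the maximum have no effect. They
   matter only for [zetahat > 1/e], where the denominator is negative. *)
Definition call_bound (R : realType) (zeta zetahat : R) : R :=
  Num.max 1 `|ln (ln (1 / zeta)) / ln (ln (1 / zetahat))|.

(* Main.v *)
Require Import Defs.
From HB Require Import structures.
From mathcomp Require Import all_boot all_order all_algebra.
From mathcomp Require Import all_classical all_reals all_analysis.
From mathcomp Require Import ring lra.

(** The number of calls is doubly logarithmic because a refinement squares the gap
    [x^T s]. A call for the refining problem returns a point of gap at most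
    [q = n * zetahat < 1], and going back to the original variables divides both its
    primal and its dual slack variables by [nabla = 1 / gap]; the new gap is at most
    [q * gap ^ 2] ([ir_iterate_gap]). So the gap of the iterate number [k + 1] is at most
    [q ^ (2 ^ k)], and while it exceeds [zeta], two logarithms give
    [k * ln 2 + ln (ln (1 / q)) < ln (ln (1 / zeta))] ([iterated_square_count]). For a
    given [zetahat] the condition [n * zetahat < 1] leaves finitely many dimensions, so
    that [q] is bounded away from 1 uniformly ([uniform_gap_bound]), and dividing by
    [ln (ln (1 / zetahat))], which is fixed too, only changes the constant.

    The rest of the work shows that every call is well posed and terminates.

    - A starting point exists ([ipm_input_exists]). From an interior feasible point one
      gets a point of the central path, where all the products [x_i s_i] are equal, by
      maximising [(\prod_i x_i s_i) * (K - x^T s)] over the feasible points of gap at most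
      [K]. This set is compact, the maximiser is interior, and the derivative along the
      Newton direction towards the products [K - x^T s] is proportional to
      [\sum_i (K - x^T s - x_i s_i) ^ 2 / (x_i s_i)], which must therefore vanish
      ([central_point_exists]). The refining problem inherits an interior feasible point
      from the current iterate ([refining_interior]).

    - The Newton system is square and nonsingular at interior points, since [dx] and [ds]
      are orthogonal ([newton_solvable]). An inexact step stays in the neighbourhood of the
      central path and decreases the duality measure by a factor that depends on [n] only
      ([ipm_step_nbhd]), whence termination ([ipm_terminates_nbhd]). All iterates are
      interior, so that the gap never vanishes.

    In dimension [n = 0] every feasible point is optimal, and a single call is made. *)

Set Implicit Arguments.
Unset Strict Implicit.
Unset Printing Implicit Defensive.

Import Order.TTheory GRing.Theory Num.Theory.
Import numFieldNormedType.Exports.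

Local Open Scope ring_scope.

(** * Euclidean and spectral norms *)

Section EuclideanNorm.
Variable R : realType.
Implicit Types n p : nat.

Lemma sumsq_ge0 (I : finType) (a : I -> R) : 0 <= \sum_i a i ^+ 2.
Proof. by apply: sumr_ge0 => i _; exact: sqr_ge0. Qed.

Lemma sum_CauchySchwarz (I : finType) (a b : I -> R) :
  (\sum_i a i * b i) ^+ 2 <= (\sum_i a i ^+ 2) * (\sum_i b i ^+ 2).
Proof.
have : 0 <= \sum_i \sum_j (a i * b j - a j * b i) ^+ 2.
  by apply: sumr_ge0 => i _; exact: sumsq_ge0.
rewrite (_ : \sum_i _ = 2%:R * ((\sum_i a i ^+ 2) * (\sum_i b i ^+ 2)
                                - (\sum_i a i * b i) ^+ 2)).
  by rewrite pmulr_rge0 ?ltr0n// subr_ge0.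
transitivity (\sum_i \sum_j (a i ^+ 2 * b j ^+ 2 - 2%:R * (a i * b i * (a j * b j))
                             + b i ^+ 2 * a j ^+ 2)).
  by apply: eq_bigr => i _; apply: eq_bigr => j _; ring.
under eq_bigr => i _ do
  rewrite big_split sumrB /= -!mulr_sumr.
by rewrite big_split sumrB /= -!mulr_sumr -!mulr_suml; ring.
Qed.

Lemma norm2_ge0 n (v : 'cV[R]_n) : 0 <= norm2 v.
Proof. exact: sqrtr_ge0. Qed.

Lemma norm2_sqr n (v : 'cV[R]_n) : norm2 v ^+ 2 = \sum_i v i 0 ^+ 2.
Proof. by rewrite /norm2 sqr_sqrtr// sumsq_ge0. Qed.

Lemma norm2_le n (v : 'cV[R]_n) c :
  0 <= c -> (norm2 v <= c) = (\sum_i v i 0 ^+ 2 <= c ^+ 2).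
Proof. by move=> c0; rewrite -norm2_sqr ler_pXn2r// nnegrE norm2_ge0. Qed.

Lemma norm2D n (u v : 'cV[R]_n) : norm2 (u + v) <= norm2 u + norm2 v.
Proof.
have cs : \sum_i u i 0 * v i 0 <= norm2 u * norm2 v.
  apply: le_trans (ler_norm _) _.
  rewrite -ler_sqr ?nnegrE ?mulr_ge0 ?norm2_ge0//.
  by rewrite real_normK ?num_real// exprMn !norm2_sqr sum_CauchySchwarz.
rewrite norm2_le ?addr_ge0 ?norm2_ge0// sqrrD !norm2_sqr.
rewrite (_ : \sum_i _ = \sum_i u i 0 ^+ 2 + (\sum_i u i 0 * v i 0) *+ 2
    + \sum_i v i 0 ^+ 2); first by rewrite lerD2r lerD2l lerMn2r.
by rewrite -sumrMnl -!big_split; apply: eq_bigr => i _; rewrite mxE sqrrD.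
Qed.

Lemma norm2Z n (a : R) (v : 'cV[R]_n) : norm2 (a *: v) = `|a| * norm2 v.
Proof.
rewrite /norm2 -sqrtr_sqr -sqrtrM ?sqr_ge0//; congr Num.sqrt.
by rewrite mulr_sumr; apply: eq_bigr => i _; rewrite mxE exprMn.
Qed.

Lemma norm2_0 n : norm2 (0 : 'cV[R]_n) = 0.
Proof. by rewrite -(scale0r 0) norm2Z normr0 mul0r. Qed.

Lemma norm2_eq0 n (v : 'cV[R]_n) : norm2 v = 0 -> v = 0.
Proof.
move=> v0; apply/matrixP => i j; rewrite mxE ord1; apply/eqP.
have := norm2_sqr v; rewrite v0 expr0n => /esym/eqP.
rewrite psumr_eq0 => [|k _]; last exact: sqr_ge0.
by move=> /allP/(_ i (mem_index_enum _)); rewrite sqrf_eq0.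
Qed.

(** The Frobenius norm bounds the set whose supremum is the operator norm. *)
Lemma opnorm2_ub n p (M : 'M[R]_(n, p)) (v : 'cV[R]_p) :
  norm2 v <= 1 -> norm2 (M *m v) <= opnorm2 M.
Proof.
move=> v1; apply: ub_le_sup; last by exists v.
exists (Num.sqrt (\sum_i \sum_j M i j ^+ 2)) => _ [u u1 ->].
rewrite norm2_le ?sqrtr_ge0// sqr_sqrtr; last first.
  by apply: sumr_ge0 => i _; exact: sumsq_ge0.
apply: ler_sum => i _; rewrite mxE.
apply: le_trans (sum_CauchySchwarz _ _) _.
by rewrite ler_piMr ?sumsq_ge0// -norm2_sqr expr_le1// norm2_ge0.
Qed.

Lemma opnorm2_ge0 n p (M : 'M[R]_(n, p)) : 0 <= opnorm2 M.
Proof.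
by apply: le_trans (norm2_ge0 (M *m 0)) (opnorm2_ub _ _); rewrite norm2_0.
Qed.

Lemma norm2_mulmx n p (M : 'M[R]_(n, p)) (v : 'cV[R]_p) :
  norm2 (M *m v) <= opnorm2 M * norm2 v.
Proof.
have [v0|v0] := eqVneq (norm2 v) 0.
  by rewrite v0 mulr0 (norm2_eq0 v0) mulmx0 norm2_0.
have v_gt0 : 0 < norm2 v by rewrite lt_def v0 norm2_ge0.
have normZ w : norm2 ((norm2 v)^-1 *: w) = (norm2 v)^-1 * norm2 w :> R.
  by rewrite norm2Z ger0_norm ?invr_ge0 ?norm2_ge0.
rewrite -ler_pdivrMr// mulrC -normZ scalemxAr.
by apply: opnorm2_ub; rewrite normZ mulVf.
Qed.

End EuclideanNorm.

(** * Balanced families *)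

Section OrthogonalProducts.
Variables (R : realType) (I : finType).
Implicit Types a b q : I -> R.

Lemma sumsq_le_sqrsum b : (forall i, 0 <= b i) -> \sum_i b i ^+ 2 <= (\sum_i b i) ^+ 2.
Proof.
move=> b0; rewrite expr2 mulr_suml; apply: ler_sum => i _.
rewrite expr2 ler_wpM2l// (bigD1 i)//= lerDl.
exact: sumr_ge0.
Qed.

(** The positive and the negative part of [q] have the same sum, which is at most the sum
    of [a], and each contributes at most the square of that sum. *)
Lemma sumsq_le_balanced q a : \sum_i q i = 0 -> (forall i, q i <= a i) ->
  (forall i, 0 <= a i) -> \sum_i q i ^+ 2 <= 2%:R * (\sum_i a i) ^+ 2.
Proof.
move=> q0 qa a0.
pose pos i := Num.max (q i) 0; pose neg i := Num.max (- q i) 0.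
have pos0 i : 0 <= pos i by rewrite le_max lexx orbT.
have neg0 i : 0 <= neg i by rewrite le_max lexx orbT.
have qE i : q i = pos i - neg i.
  by rewrite /pos /neg; case: (lerP (q i) 0); case: (lerP (- q i) 0); lra.
have q2E i : q i ^+ 2 = pos i ^+ 2 + neg i ^+ 2.
  by rewrite /pos /neg; case: (lerP (q i) 0); case: (lerP (- q i) 0); nra.
have sum_neg : \sum_i neg i = \sum_i pos i.
  apply/esym/eqP; rewrite -subr_eq0 -sumrB; apply/eqP; rewrite -[RHS]q0.
  exact: eq_bigr.
have sum_pos : (\sum_i pos i) ^+ 2 <= (\sum_i a i) ^+ 2.
  rewrite ler_sqr ?nnegrE ?sumr_ge0//.
  by apply: ler_sum => i _; rewrite ge_max qa a0.
under eq_bigr => i _ do rewrite q2E.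
rewrite big_split /= mulr_natl mulr2n lerD//; apply: le_trans sum_pos.
  exact: sumsq_le_sqrsum.
by rewrite -sum_neg sumsq_le_sqrsum.
Qed.

End OrthogonalProducts.

(** * Bases of the null space *)

Section NullBasis.
Variables (R : realType) (m n : nat).
Implicit Types (A : 'M[R]_(m, n)) (V : 'M[R]_(n, n - m)).

Lemma null_basis_exists A : \rank A = m -> exists V, null_basis A V.
Proof.
move=> rkA.
have rfA : row_full A^T by rewrite /row_full mxrank_tr rkA.
pose f : 'I_m -> 'I_n := fullrankfun rfA.
have f_inj : injective f := @fullrankfun_inj _ _ _ _ rfA.
have unit_f : colsub f A \in unitmx.
  rewrite -unitmx_tr; suff -> : (colsub f A)^T = rowsub f A^T.
    exact: fullrowsub_unit.
  by apply/matrixP => i j; rewrite !mxE.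
pose others := ~: (f @: [set: 'I_m])%SET.
have card_others : #|others| = (n - m)%N.
  by rewrite cardsCs finset.setCK card_imset// cardsT !card_ord.
pose g (j : 'I_(n - m)) : 'I_n := enum_val (cast_ord (esym card_others) j).
have g_inj : injective g by move=> i j /enum_val_inj/cast_ord_inj.
have fg i j : f i <> g j.
  move=> fij; have := enum_valP (cast_ord (esym card_others) j).
  by rewrite -/(g j) -fij inE imset_f.
have le_mn : (m <= n)%N by rewrite -{1}rkA rank_leq_col.
pose h (u : 'I_m + 'I_(n - m)) := match u with inl i => f i | inr j => g j end.
have h_bij : bijective h.
  apply: inj_card_bij; last by rewrite card_sum !card_ord subnKC.
  move=> [i|i] [j|j] /=; first by move=> /f_inj ->.
  - by move=> /fg.
  - by move=> /esym/fg.
  - by move=> /g_inj ->.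
have [h' hK _] := h_bij.
exists (\matrix_(i, k) match h' i with
  | inl j => (invmx (colsub f A) *m colsub g A) j k
  | inr j => - (j == k)%:R end).
exists f, g; split=> //; apply/matrixP => i j; rewrite !mxE.
  by rewrite -[f i]/(h (inl i)) hK mxE.
by rewrite -[g i]/(h (inr i)) hK.
Qed.

Lemma null_basis_leq A V : null_basis A V -> (m <= n)%N.
Proof.
move=> [f [g [/bij_eq_card + _ _ _]]]; rewrite card_sum !card_ord => mn.
by rewrite -mn leq_addr.
Qed.

Lemma null_basis_mulmx A V : null_basis A V -> A *m V = 0.
Proof.
move=> [f [g [fg_bij unit_f Vf Vg]]].
have -> : A *m V = colsub f A *m rowsub f V + colsub g A *m rowsub g V.
  apply/matrixP => i j; rewrite !mxE (reindex _ (onW_bij _ fg_bij)) big_sumType.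
  by congr (_ + _); apply: eq_bigr => k _; rewrite !mxE.
by rewrite Vf Vg mulmxA mulmxV// mul1mx mulmxN mulmx1 subrr.
Qed.

Lemma null_basis_inj A V (l : 'cV_(n - m)) : null_basis A V -> V *m l = 0 -> l = 0.
Proof.
move=> [f [g [_ _ _ Vg]]] Vl.
have : rowsub g V *m l = 0 by rewrite mul_rowsub_mx Vl mxsub_const.
by rewrite Vg mulNmx mul1mx => /eqP; rewrite oppr_eq0 => /eqP.
Qed.

Lemma null_basis_tr_inj A V (y : 'cV_m) : null_basis A V -> A^T *m y = 0 -> y = 0.
Proof.
move=> [f [_ [_ unit_f _ _]]] Ay.
have : (colsub f A)^T *m y = 0.
  by rewrite (_ : _^T = rowsub f A^T) ?trmx_mxsub// mul_rowsub_mx Ay mxsub_const.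
by move=> /(congr1 (mulmx (invmx (colsub f A)^T))); rewrite mulKmx ?unitmx_tr// mulmx0.
Qed.

End NullBasis.

(** * The Newton system *)

Section NewtonStep.
Variables (R : realType) (m n : nat).
Implicit Types (P : lo_problem R m n) (z : pdpoint R m n) (sol : solver).
Implicit Types (V : 'M[R]_(n, n - m)) (l : 'cV[R]_(n - m)) (d : 'cV[R]_m).

(** In the usual notation for the Newton step, [V *m l], [d] and [- A^T *m d] are [dx], [dy]
    and [ds]. *)
Definition displace P V z l d : pdpoint R m n :=
  Point (px z + V *m l) (py z + d) (ps z - (lo_A P)^T *m d).

Lemma gapE z : gap z = \sum_i px z i 0 * ps z i 0.
Proof. by rewrite /gap mxE; apply: eq_bigr => i _; rewrite mxE. Qed.

Lemma gap_mu z : (0 < n)%N -> gap z = n%:R * mu z.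
Proof. by move=> n0; rewrite /mu mulrC divfK// pnatr_eq0 -lt0n. Qed.

Lemma gap_gt0 P z : (0 < n)%N -> interior_feasible P z -> 0 < gap z.
Proof.
move=> n0 [_ x0 s0]; rewrite gapE (bigD1 (Ordinal n0))//= ltr_pwDl ?mulr_gt0//.
by apply: sumr_ge0 => i _; rewrite mulr_ge0 ?ltW.
Qed.

Lemma mu_gt0 P z : (0 < n)%N -> interior_feasible P z -> 0 < mu z.
Proof. by move=> n0 zI; rewrite divr_gt0 ?ltr0n// (gap_gt0 n0 zI). Qed.

Lemma interior_feasibleW P z : interior_feasible P z -> feasible P z.
Proof. by move=> [zF x0 s0]; split=> // i; rewrite ltW. Qed.

Lemma displace_eq_feasible P V z l d :
  null_basis (lo_A P) V -> eq_feasible P z -> eq_feasible P (displace P V z l d).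
Proof.
move=> nbV [xF sF]; split=> /=.
  by rewrite mulmxDr mulmxA (null_basis_mulmx nbV) mul0mx addr0.
by rewrite mulmxDr addrACA subrr addr0.
Qed.

(** [V l] lies in the kernel of [A] and [A^T d] in the row space. *)
Lemma displacement_orthogonal P V l d : null_basis (lo_A P) V ->
  \sum_i (V *m l) i 0 * (- ((lo_A P)^T *m d)) i 0 = 0.
Proof.
move=> nbV; transitivity (((V *m l)^T *m - ((lo_A P)^T *m d)) 0 0).
  by rewrite [RHS]mxE; apply: eq_bigr => i _; rewrite [in RHS]mxE.
rewrite mulmxN mulmxA -trmx_mul mulmxA (null_basis_mulmx nbV).
by rewrite mul0mx trmx0 mul0mx oppr0 mxE.
Qed.

Lemma newton_mxE P V z l d i :
  (newton_mx P V z *m col_mx d l) i 0 =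
  px z i 0 * (- ((lo_A P)^T *m d)) i 0 + ps z i 0 * (V *m l) i 0.
Proof.
rewrite /newton_mx mul_row_col mulNmx -!mulmxA /Xmx /Smx !mul_diag_mx.
by rewrite !mxE mulrN.
Qed.

(** Componentwise, [x ds + s dx = 0] with [x, s > 0] gives [dx] and [ds] opposite signs,
    so orthogonality forces both to vanish. *)
Lemma newton_mx_inj P V z (w : 'cV[R]_(m + (n - m))) :
    null_basis (lo_A P) V -> interior_feasible P z ->
  newton_mx P V z *m w = 0 -> w = 0.
Proof.
move=> nbV [_ x0 s0]; rewrite -[w]vsubmxK.
move: (usubmx w) (dsubmx w) => d l Mw0.
have Mw i : px z i 0 * (- ((lo_A P)^T *m d)) i 0 = - (ps z i 0 * (V *m l) i 0).
  by apply/eqP; rewrite -addr_eq0 -newton_mxE Mw0 mxE.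
have dxds i : (V *m l) i 0 * (- ((lo_A P)^T *m d)) i 0 =
    - (ps z i 0 / px z i 0 * (V *m l) i 0 ^+ 2).
  apply: (mulfI (lt0r_neq0 (x0 i))); rewrite mulrCA Mw.
  by field; rewrite lt0r_neq0.
have := displacement_orthogonal l d nbV.
under eq_bigr do rewrite dxds.
rewrite sumrN => /eqP; rewrite oppr_eq0 psumr_eq0 => [|i _]; last first.
  by rewrite mulr_ge0 ?sqr_ge0// divr_ge0 ?ltW.
move=> /allP dx0.
have Vl0 : V *m l = 0.
  apply/matrixP => i j; rewrite ord1 [RHS]mxE; apply/eqP.
  have := dx0 i (mem_index_enum _).
  by rewrite mulf_eq0 sqrf_eq0 gt_eqF ?divr_gt0.
have Ad0 : (lo_A P)^T *m d = 0.
  apply/matrixP => i j; rewrite ord1 [RHS]mxE; apply/eqP.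
  by have /eqP := Mw i; rewrite Vl0 !mxE mulr0 oppr0 mulf_eq0 oppr_eq0 gt_eqF.
by rewrite (null_basis_inj nbV Vl0) (null_basis_tr_inj nbV Ad0) col_mx0.
Qed.

Lemma newton_mx_rank P V z : null_basis (lo_A P) V -> interior_feasible P z ->
  \rank (newton_mx P V z) = n.
Proof.
move=> nbV zI; rewrite -mxrank_tr -[RHS](subnKC (null_basis_leq nbV)).
apply/eqP/inj_row_free => v vM; apply: trmx_inj; rewrite trmx0.
by apply: (newton_mx_inj nbV zI); rewrite -[LHS]trmxK trmx_mul trmxK vM trmx0.
Qed.

Lemma newton_solvable P V z (r : 'cV[R]_n) :
    null_basis (lo_A P) V -> interior_feasible P z ->
  exists l d, newton_mx P V z *m col_mx d l = r.
Proof.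
move=> nbV zI.
have /row_freeP[B MB] : row_free (newton_mx P V z).
  by rewrite /row_free (newton_mx_rank nbV zI).
by exists (dsubmx (B *m r)), (usubmx (B *m r)); rewrite vsubmxK mulmxA MB mul1mx.
Qed.

Lemma ipm_step_exists sol P V z : null_basis (lo_A P) V -> interior_feasible P z ->
  exists z', ipm_step sol P V z z'.
Proof.
move=> nbV zI; have [l [d Mw]] := newton_solvable (newton_rhs z) nbV zI.
have tol_ge0 : 0 <= Defs.eta R * mu z.
  rewrite mulr_ge0 ?divr_ge0//.
  have [_ x0 s0] := zI.
  by rewrite gapE; apply: sumr_ge0 => i _; rewrite mulr_ge0 ?ltW.
exists (displace P V z l d), l, d; split=> //; case: sol => /=.
  by exists (col_mx d l); rewrite // subrr norm2_0 divr_ge0 ?opnorm2_ge0.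
by rewrite Mw subrr norm2_0.
Qed.

(** A small error in the solution gives a small residual: this makes the two accuracy
    criteria comparable. *)
Lemma inexact_residual sol p (M : 'M[R]_(n, p)) r tol w :
  0 <= tol -> inexact_solution sol M r tol w -> norm2 (M *m w - r) <= tol.
Proof.
move=> tol0; case: sol => //= -[w0 <- ww0]; rewrite -mulmxBr.
apply: le_trans (norm2_mulmx _ _) _.
have [M0|M0] := eqVneq (opnorm2 M) 0; first by rewrite M0 mul0r.
by rewrite mulrC -ler_pdivlMr// lt_def M0 opnorm2_ge0.
Qed.

Lemma nbhd_normE z :
  norm2 (Xmx z *m Smx z *m e1 R n - mu z *: e1 R n) =
  norm2 (\col_i (px z i 0 * ps z i 0 - mu z)).
Proof.
congr norm2; apply/matrixP => i j; rewrite ord1 /Xmx /Smx -mulmxA !mul_diag_mx.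
by rewrite !mxE !mulr1.
Qed.

End NewtonStep.

(** * One step of the interior point method *)

Section ShortStep.
Variables (R : realType) (m n : nat).
Hypothesis n_gt0 : (0 < n)%N.
Implicit Types (P : lo_problem R m n) (z : pdpoint R m n) (sol : solver).
Implicit Types (V : 'M[R]_(n, n - m)) (l : 'cV[R]_(n - m)) (d : 'cV[R]_m).

Definition step_factor : R := 1 - 1 / 100%:R / Num.sqrt n%:R.

Let natn_gt0 : 0 < n%:R :> R. Proof. by rewrite ltr0n. Qed.

Let sqrtn_ge1 : 1 <= Num.sqrt n%:R :> R.
Proof. by rewrite -[leLHS]sqrtr1 ler_sqrt ?ler1n. Qed.

Let sqrtn_gt0 : 0 < Num.sqrt n%:R :> R.
Proof. exact: lt_le_trans ltr01 sqrtn_ge1. Qed.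

Let sqr_sqrtn : Num.sqrt n%:R ^+ 2 = n%:R :> R.
Proof. by rewrite sqr_sqrtr. Qed.

Lemma step_factor_bounds : 0 <= step_factor /\ step_factor < 1.
Proof.
rewrite /step_factor; split; last by rewrite ltrBlDr ltrDl !divr_gt0.
by rewrite subr_ge0 ler_pdivrMr//; move: sqrtn_ge1; lra.
Qed.

(** The constants [th + 13/100] and [142/100] round up those of the estimate for a step:
    [th ^ 2 + (11/100) ^ 2 <= (th + 3/100) ^ 2], to which the residual adds [1/10], and
    [2 <= (142/100) ^ 2]. The factor [79/100] is the worst decrease of the duality measure,
    which is that for [n = 1]. *)
Lemma theta_bounds sol (th := theta R sol) :
  [/\ 2%:R / 10%:R <= th, th <= 3%:R / 10%:R
  & 142%:R / 100%:R * ((th + 13%:R / 100%:R) ^+ 2 / (4%:R * (1 - th)))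
    <= th * (79%:R / 100%:R) - 1 / 10%:R].
Proof.
rewrite /th => {th}; case: sol; rewrite /theta; split; try lra.
  by rewrite [leLHS]mulrA ler_pdivrMr; lra.
by rewrite [leLHS]mulrA ler_pdivrMr; lra.
Qed.

Lemma norm2_entry (v : 'cV[R]_n) i : `|v i 0| <= norm2 v.
Proof.
rewrite -ler_sqr ?nnegrE ?norm2_ge0// real_normK ?num_real// norm2_sqr.
by rewrite (bigD1 i)//= lerDl; apply: sumr_ge0 => j _; exact: sqr_ge0.
Qed.

Lemma sum_le_norm2 (v : 'cV[R]_n) : `|\sum_i v i 0| <= Num.sqrt n%:R * norm2 v.
Proof.
rewrite -ler_sqr ?nnegrE ?mulr_ge0 ?norm2_ge0 ?sqrtr_ge0//.
rewrite real_normK ?num_real// exprMn norm2_sqr sqr_sqrtn.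
have := sum_CauchySchwarz (fun i => v i 0) (fun=> 1).
under eq_bigr do rewrite mulr1.
under [X in _ <= _ * X -> _]eq_bigr do rewrite expr1n.
by rewrite sumr_const card_ord mulrC.
Qed.

(** Removing the mean is an orthogonal projection. *)
Lemma norm2_centered (v : 'cV[R]_n) :
  norm2 (\col_i (v i 0 - (\sum_j v j 0) / n%:R)) <= norm2 v.
Proof.
set a := _ / _.
have sumv : \sum_j v j 0 = n%:R * a by rewrite /a mulrC divfK ?gt_eqF.
rewrite norm2_le ?norm2_ge0// norm2_sqr.
under eq_bigr do rewrite mxE sqrrB.
rewrite big_split sumrB /= sumrMnl -mulr_suml sumv sumr_const card_ord.
rewrite -[_ *+ n]mulr_natl.
have : 0 <= n%:R * a ^+ 2 by rewrite mulr_ge0 ?sqr_ge0.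
lra.
Qed.

(** The products [dx_i ds_i] sum to zero and satisfy
    [4 (x_i s_i) (dx_i ds_i) <= (x_i ds_i + s_i dx_i) ^ 2], so that they are balanced
    families of second order in the displacement. *)
Lemma norm2_orthogonal_products (x s dx ds : 'I_n -> R) k :
    0 < k -> (forall i, k <= x i * s i) -> \sum_i dx i * ds i = 0 ->
  norm2 (\col_i (dx i * ds i)) <=
  142%:R / 100%:R * (norm2 (\col_i (x i * ds i + s i * dx i)) ^+ 2 / (4%:R * k)).
Proof.
move=> k0 kxs dxds0; set N := norm2 _ ^+ 2 / _.
have k4 : 0 < 4%:R * k by rewrite mulr_gt0.
pose a i := (x i * ds i + s i * dx i) ^+ 2 / (4%:R * k).
have a0 i : 0 <= a i by rewrite divr_ge0 ?sqr_ge0 ?(ltW k4).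
have qa i : dx i * ds i <= a i.
  rewrite ler_pdivlMr//.
  have := sqr_ge0 (x i * ds i - s i * dx i).
  have := sqr_ge0 (x i * ds i + s i * dx i).
  have [q0|q0] := leP (dx i * ds i) 0.
    have := mulr_ge0_le0 (ltW k0) q0; lra.
  have := ler_wpM2r (ltW q0) (kxs i); lra.
have sum_a : \sum_i a i = N.
  rewrite -mulr_suml /N norm2_sqr; congr (_ / _).
  by apply: eq_bigr => i _; rewrite mxE.
have N0 : 0 <= N by rewrite -sum_a sumr_ge0.
have c0 : 0 <= 142%:R / 100%:R * N by rewrite mulr_ge0// divr_ge0.
rewrite norm2_le//; under eq_bigr do rewrite mxE.
apply: le_trans (sumsq_le_balanced dxds0 qa a0) _; rewrite sum_a.
by have := sqr_ge0 N; lra.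
Qed.

(** The deviation [x_i s_i - mu] is orthogonal to the constant vector [(1 - beta) mu], whose
    squared norm is [n (1 - beta) ^ 2 mu ^ 2 = (11/100) ^ 2 mu ^ 2]. *)
Lemma norm2_newton_rhs z th : 0 < mu z -> 2%:R / 10%:R <= th ->
    norm2 (\col_i (px z i 0 * ps z i 0 - mu z)) <= th * mu z ->
  norm2 (newton_rhs z) <= (th + 3%:R / 100%:R) * mu z.
Proof.
move=> mu0 th2; set v := \col_i _ => v_le.
have c0 : 0 <= (th + 3%:R / 100%:R) * mu z.
  by rewrite mulr_ge0 ?(ltW mu0)//; lra.
have v0 : \sum_i v i 0 = 0.
  under eq_bigr do rewrite mxE.
  by rewrite sumrB -gapE gap_mu// sumr_const card_ord -[mu z *+ n]mulr_natl subrr.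
have th0 : 0 <= th * mu z by rewrite mulr_ge0 ?(ltW mu0)//; lra.
have v_sqr : norm2 v ^+ 2 <= (th * mu z) ^+ 2 by rewrite ler_sqr ?nnegrE ?norm2_ge0.
have {c0} -> : (norm2 (newton_rhs z) <= (th + 3%:R / 100%:R) * mu z) =
    ((11%:R / 100%:R) ^+ 2 * mu z ^+ 2 + norm2 v ^+ 2
     <= ((th + 3%:R / 100%:R) * mu z) ^+ 2).
  rewrite norm2_le//; congr (_ <= _).
  transitivity (\sum_i (((1 - beta R n) * mu z) ^+ 2
      + (2%:R * (1 - beta R n) * mu z * v i 0 + v i 0 ^+ 2))).
    by apply: eq_bigr => i _; rewrite /newton_rhs /Xmx mul_diag_mx !mxE; ring.
  rewrite 2!big_split /= sumr_const card_ord -mulr_sumr v0 mulr0 add0r norm2_sqr.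
  congr (_ + _); rewrite -[LHS]mulr_natl /beta.
  move: (Num.sqrt n%:R) sqrtn_gt0 sqr_sqrtn => q q_gt0 <-.
  by field; rewrite gt_eqF.
have th_sqr : (11%:R / 100%:R) ^+ 2 + th ^+ 2 <= (th + 3%:R / 100%:R) ^+ 2 by lra.
have := ler_wpM2r (sqr_ge0 (mu z)) th_sqr.
by move: v_sqr; rewrite !exprMn mulrDl; lra.
Qed.

Section Displacement.
Variables (P : lo_problem R m n) (V : 'M[R]_(n, n - m)) (z : pdpoint R m n).
Variables (l : 'cV[R]_(n - m)) (d : 'cV[R]_m) (r : 'cV[R]_n).
Hypothesis nbV : null_basis (lo_A P) V.
Hypothesis newton_r : newton_mx P V z *m col_mx d l = newton_rhs z + r.

Let z' := displace P V z l d.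
Let dx i := (V *m l) i 0.
Let ds i := (- ((lo_A P)^T *m d)) i 0.

Let dxdsE i : px z i 0 * ds i + ps z i 0 * dx i
  = beta R n * mu z - px z i 0 * ps z i 0 + r i 0.
Proof.
rewrite -newton_mxE newton_r [LHS]mxE; congr (_ + _).
by rewrite /newton_rhs /Xmx mul_diag_mx !mxE mulr1.
Qed.

Lemma displace_product i :
  px z' i 0 * ps z' i 0 = beta R n * mu z + r i 0 + dx i * ds i.
Proof.
have -> : beta R n * mu z + r i 0 =
    px z i 0 * ps z i 0 + (px z i 0 * ds i + ps z i 0 * dx i).
  by rewrite dxdsE; ring.
by rewrite [px z' i 0]mxE [ps z' i 0]mxE /dx /ds; ring.
Qed.

Lemma displace_mu : mu z' = beta R n * mu z + (\sum_i r i 0) / n%:R.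
Proof.
rewrite /mu gapE; under eq_bigr do rewrite displace_product.
rewrite 2!big_split /= displacement_orthogonal// addr0 sumr_const card_ord.
by rewrite -[_ *+ n]mulr_natl mulrDl mulrC mulKf ?gt_eqF.
Qed.

(** A full step cannot make both [x_i] and [s_i] nonpositive, because
    [s_i (x_i + dx_i) + x_i (s_i + ds_i) = x_i s_i + beta mu + r_i]. *)
Lemma displace_positive i : 0 < px z i 0 -> 0 < ps z i 0 ->
    0 < px z i 0 * ps z i 0 + beta R n * mu z + r i 0 ->
    0 < px z' i 0 * ps z' i 0 ->
  0 < px z' i 0 /\ 0 < ps z' i 0.
Proof.
move=> x0 s0 sum0.
have [x'_gt0 | x'_le0] := ltP 0 (px z' i 0); first by rewrite pmulr_rgt0.
have [s'_gt0 | s'_le0 _] := ltP 0 (ps z' i 0).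
  by rewrite pmulr_lgt0// ltNge x'_le0.
exfalso; have := mulr_ge0_le0 (ltW s0) x'_le0; have := mulr_ge0_le0 (ltW x0) s'_le0.
have -> : px z' i 0 = px z i 0 + dx i by rewrite [LHS]mxE.
have -> : ps z' i 0 = ps z i 0 + ds i by rewrite [LHS]mxE.
have := dxdsE i; lra.
Qed.

End Displacement.

(** The products of the new iterate are [beta mu + r_i + dx_i ds_i]. The residual [r]
    moves the duality measure by at most [mu / (10 sqrt n)], less than the decrease
    [11 mu / (100 sqrt n)] aimed at; the deviation from the mean consists of the centered
    residual and of the second-order term. *)
Lemma ipm_step_nbhd sol P V z z' :
    null_basis (lo_A P) V -> nbhd (theta R sol) P z -> ipm_step sol P V z z' ->
  nbhd (theta R sol) P z' /\ mu z' <= step_factor * mu z.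
Proof.
move=> nbV [zI z_near] [l [d [w_inexact ->]]] {z'}.
rewrite -[Point _ _ _]/(displace P V z l d); set z' := displace P V z l d.
have mu0 := mu_gt0 n_gt0 zI; have [zF x0 s0] := zI.
move: z_near; rewrite nbhd_normE => z_near.
have [th2 th3 th_bound] := theta_bounds sol.
move: (theta R sol) th2 th3 th_bound z_near => th th2 th3 th_bound z_near.
pose r := newton_mx P V z *m col_mx d l - newton_rhs z.
have r_small : norm2 r <= 1 / 10%:R * mu z.
  by apply: inexact_residual w_inexact; rewrite mulr_ge0 ?ltW// divr_gt0.
have newton_r : newton_mx P V z *m col_mx d l = newton_rhs z + r.
  by rewrite /r addrCA subrr addr0.
move: r r_small newton_r => r r_small newton_r {w_inexact}.
have mu'E : mu z' = beta R n * mu z + (\sum_i r i 0) / n%:R by exact: displace_mu.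
have xs'E i : px z' i 0 * ps z' i 0 =
    beta R n * mu z + r i 0 + (V *m l) i 0 * (- ((lo_A P)^T *m d)) i 0.
  exact: displace_product.
have th1_gt0 : 0 < 1 - th by lra.
have near_mu i : (1 - th) * mu z <= px z i 0 * ps z i 0.
  have := le_trans (norm2_entry _ i) z_near; rewrite mxE ler_norml => /andP[+ _].
  lra.
have q_small : norm2 (\col_i ((V *m l) i 0 * (- ((lo_A P)^T *m d)) i 0)) <=
    (th * (79%:R / 100%:R) - 1 / 10%:R) * mu z.
  have k_gt0 : 0 < (1 - th) * mu z by rewrite mulr_gt0.
  have := norm2_orthogonal_products k_gt0 near_mu (displacement_orthogonal l d nbV).
  move=> /le_trans; apply.
  rewrite (_ : \col_i (px z i 0 * _ + _) = newton_mx P V z *m col_mx d l); last first.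
    by apply/matrixP => i j; rewrite ord1 mxE newton_mxE.
  have u_small : norm2 (newton_mx P V z *m col_mx d l) <= (th + 13%:R / 100%:R) * mu z.
    rewrite newton_r; apply: le_trans (norm2D _ _) _.
    have := norm2_newton_rhs mu0 th2 z_near.
    by move: r_small; lra.
  have u_sqr : norm2 (newton_mx P V z *m col_mx d l) ^+ 2 <=
      ((th + 13%:R / 100%:R) * mu z) ^+ 2.
    rewrite ler_sqr ?nnegrE ?norm2_ge0//.
    exact: le_trans (norm2_ge0 _) u_small.
  apply: le_trans (ler_wpM2r (ltW mu0) th_bound); rewrite -[leRHS]mulrA.
  rewrite ler_pM2l; last by rewrite divr_gt0.
  rewrite ler_pdivrMr; last by rewrite mulr_gt0.
  apply: le_trans u_sqr _; rewrite le_eqVlt; apply/orP; left; apply/eqP.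
  by field; rewrite gt_eqF.
have mean_small : `|(\sum_i r i 0) / n%:R| <= 1 / 10%:R * mu z / Num.sqrt n%:R.
  rewrite normrM normfV (ger0_norm (ltW natn_gt0)) ler_pdivrMr//.
  apply: le_trans (sum_le_norm2 _) _.
  rewrite -[X in _ <= _ * X]sqr_sqrtn.
  rewrite (_ : _ / _ * _ ^+ 2 = Num.sqrt n%:R * (1 / 10%:R * mu z)).
    by rewrite ler_pM2l.
  by field; rewrite gt_eqF.
have mu_div_le : mu z / Num.sqrt n%:R <= mu z.
  by rewrite ler_pdivrMr// ler_peMr// ltW.
move: mean_small; rewrite ler_norml => /andP[mean_ge mean_le].
have mu'_le : mu z' <= step_factor * mu z.
  by rewrite mu'E /beta /step_factor; move: mean_le; lra.
have mu'_ge : 79%:R / 100%:R * mu z <= mu z'.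
  by rewrite mu'E /beta; move: mean_ge mu_div_le; lra.
have mu'_gt0 : 0 < mu z' by apply: lt_le_trans mu'_ge; rewrite mulr_gt0.
split; last exact: mu'_le.
have near' : norm2 (\col_i (px z' i 0 * ps z' i 0 - mu z')) <= th * mu z'.
  have -> : \col_i (px z' i 0 * ps z' i 0 - mu z') =
      \col_i (r i 0 - (\sum_j r j 0) / n%:R)
      + \col_i ((V *m l) i 0 * (- ((lo_A P)^T *m d)) i 0).
    apply/matrixP => i j; rewrite [LHS]mxE xs'E mu'E [RHS]mxE.
    by rewrite [X in _ = X + _]mxE [X in _ = _ + X]mxE; ring.
  apply: le_trans (norm2D _ _) _.
  have := norm2_centered r.
  have th_ge0 : 0 <= th by lra.
  have := ler_wpM2l th_ge0 mu'_ge.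
  by move: q_small r_small; lra.
split; last by rewrite nbhd_normE.
have pos i : 0 < px z' i 0 /\ 0 < ps z' i 0.
  apply: displace_positive (x0 i) (s0 i) _ _; first exact: newton_r.
    have := near_mu i; have := le_trans (norm2_entry r i) r_small.
    have := ler_pM2r mu0 th (3%:R / 10%:R); rewrite th3.
    rewrite ler_norml /beta => + /andP[+ _].
    by move: mu_div_le mu0; lra.
  have := le_trans (norm2_entry _ i) near'; rewrite mxE ler_norml => /andP[+ _].
  by have := mulr_gt0 th1_gt0 mu'_gt0; lra.
by split=> [|i|i]; [exact: displace_eq_feasible | case: (pos i) ..].
Qed.

End ShortStep.

(** * Termination of the interior point method *)

Section InteriorPointCall.
Variables (R : realType) (m n : nat).
Implicit Types (P : lo_problem R m n) (z : pdpoint R m n) (sol : solver).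
Implicit Types (V : 'M[R]_(n, n - m)).

Lemma optimal_dim0 P zeta z : n = 0%N -> 0 < zeta -> eq_feasible P z -> optimal P zeta z.
Proof.
move=> n0 zeta0 zF; split; last first.
  by rewrite /mu (_ : n%:R = 0) ?n0// invr0 mulr0 ltW.
by split=> // -[i /= i_lt]; exfalso; move: i_lt; rewrite n0.
Qed.

Lemma ipm_run_optimal sol P V zeta z z' : ipm_run sol P V zeta z z' -> optimal P zeta z'.
Proof. by elim. Qed.

Lemma ipm_run_nbhd sol P V zeta z z' : (0 < n)%N -> null_basis (lo_A P) V ->
  ipm_run sol P V zeta z z' -> nbhd (theta R sol) P z -> nbhd (theta R sol) P z'.
Proof.
move=> n0 nbV; elim=> // {}z {}z' z'' _ zz' _ IH z_near.
by apply: IH; have [] := ipm_step_nbhd n0 nbV z_near zz'.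
Qed.

Lemma ipm_terminates_run sol P V zeta z : ipm_terminates sol P V zeta z ->
  exists z', ipm_run sol P V zeta z z'.
Proof.
elim=> {z} [z zO|z [z' zz'] _ IH]; first by exists z; exact: Ipm_stop.
have [zO|zNO] := pselect (optimal P zeta z); first by exists z; exact: Ipm_stop.
by have [z'' z'z''] := IH z' zz'; exists z''; exact: Ipm_step zz' z'z''.
Qed.

(** The duality measure decreases geometrically along any run. *)
Lemma ipm_terminates_nbhd sol P V zeta z : 0 < zeta -> null_basis (lo_A P) V ->
  nbhd (theta R sol) P z -> ipm_terminates sol P V zeta z.
Proof.
move=> zeta0 nbV z_near.
have [n0|n_gt0] := posnP n.
  by apply: Ipm_halt; apply: optimal_dim0 => //; case: z_near => -[].
have [f0 f1] := step_factor_bounds R n_gt0; set f := step_factor R n in f0 f1.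
have [K zK] : exists K, f ^+ K * mu z <= zeta.
  have fcvg : (f ^+ k * mu z @[k --> \oo] --> (0 : R))%classic.
    rewrite -[X in (_ --> X)%classic](mul0r (mu z)); apply: cvgMl.
    by apply: cvg_expr; rewrite ger0_norm.
  have /cvgrPdist_le/(_ _ zeta0)[K _ HK] := fcvg.
  exists K; have := HK K (leqnn K); rewrite /= sub0r normrN.
  exact: le_trans (ler_norm _).
elim: K z z_near zK => [|K IH] z z_near zK.
  apply: Ipm_halt; split; first exact: interior_feasibleW z_near.1.
  by move: zK; rewrite expr0 mul1r.
apply: Ipm_continue => [|z' zz']; first exact: ipm_step_exists nbV z_near.1.
have [z'_near z'_mu] := ipm_step_nbhd n_gt0 nbV z_near zz'.
apply: IH => //; apply: le_trans zK.
by rewrite exprSr -mulrA ler_wpM2l// exprn_ge0.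
Qed.

End InteriorPointCall.

(** * Points of the central path *)

Section CentralPoint.
Variables (R : realType) (m n : nat).
Implicit Types (P : lo_problem R m n) (z : pdpoint R m n).
Implicit Types (V : 'M[R]_(n, n - m)) (l : 'cV[R]_(n - m)) (d : 'cV[R]_m).

(** Maximising this polynomial has the effect of a logarithmic barrier, without leaving
    the closed feasible set: it vanishes on the boundary. *)
Definition barrier (K : R) z : R := (\prod_i (px z i 0 * ps z i 0)) * (K - gap z).

(** The logarithmic derivative of a product. *)
Lemma deriv_prod_horner (I : Type) (e : seq I) (q : I -> {poly R}) a :
    (forall i, (q i).[a] != 0) ->
  (\prod_(i <- e) q i)^`().[a]
  = (\prod_(i <- e) q i).[a] * \sum_(i <- e) (q i)^`().[a] / (q i).[a].
Proof.
move=> q0; elim: e => [|i e IH]; first by rewrite !big_nil derivC horner0 mulr0.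
by rewrite !big_cons derivM hornerD !hornerM IH; field.
Qed.

Lemma affine_family_ge0 (I : finType) (a b : I -> R) : (forall i, 0 < a i) ->
  exists2 e : R, 0 < e & forall t, `|t| < e -> forall i, 0 <= a i + t * b i.
Proof.
move=> a0; pose c := \sum_i `|b i| / a i.
have c_ge i : `|b i| / a i <= c.
  rewrite /c (bigD1 i)//= lerDl sumr_ge0// => j _; by rewrite divr_ge0// ltW.
have c0 : 0 <= c by apply: sumr_ge0 => i _; rewrite divr_ge0// ltW.
exists (1 + c)^-1 => [|t te i]; first by rewrite invr_gt0 ltr_pwDl.
have : `|t * b i| <= a i.
  rewrite normrM; have := c_ge i; rewrite ler_pdivrMr// => b_le.
  apply: (@le_trans _ _ ((1 + c)^-1 * (c * a i))).
    by apply: ler_pM => //; exact: ltW.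
  rewrite mulrA ler_piMl ?(ltW (a0 i))// mulrC ler_pdivrMr ?mul1r ?lerDr//.
  by rewrite ltr_pwDl.
by rewrite ler_norml => /andP[+ _]; lra.
Qed.

Lemma poly_deriv_at_max (p : {poly R}) a e : 0 < e ->
  (forall t, `|t - a| < e -> p.[t] <= p.[a]) -> p^`().[a] = 0.
Proof.
move=> e0 pmax.
have der0 : is_derive a (1 : R) (horner p) 0.
  apply: (@derive1_at_max _ _ (a - e) (a + e)).
  - by rewrite lerD2l; apply: ltW; rewrite (lt_trans _ e0)// oppr_lt0.
  - by move=> t _; exact: derivable_horner.
  - by rewrite in_itv /= ltrBlDr !ltrDl e0.
  - by move=> t; rewrite in_itv /= -ltr_distl => /pmax.
transitivity ('D_1 (horner p) a); last exact: (@derive_val _ _ _ _ _ _ _ der0).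
by rewrite (@derive_val _ _ _ _ _ _ _ (is_derive_poly p a)).
Qed.

Lemma continuous_add (T : topologicalType) (f g : T -> R) :
  continuous f -> continuous g -> continuous (fun x => f x + g x).
Proof. by move=> fc gc x; apply: cvgD; [exact: fc | exact: gc]. Qed.

Lemma continuous_mul (T : topologicalType) (f g : T -> R) :
  continuous f -> continuous g -> continuous (fun x => f x * g x).
Proof. by move=> fc gc x; apply: cvgM; [exact: fc | exact: gc]. Qed.

Lemma continuous_sum (T : topologicalType) (I : finType) (f : I -> T -> R) :
  (forall i, continuous (f i)) -> continuous (fun x => \sum_i f i x).
Proof. by move=> fc; apply: continuous_big => //; exact: add_continuous. Qed.

Lemma continuous_prod (T : topologicalType) (I : finType) (f : I -> T -> R) :
  (forall i, continuous (f i)) -> continuous (fun x => \prod_i f i x).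
Proof. by move=> fc; apply: continuous_big => //; exact: mul_continuous. Qed.

Lemma continuous_affine_entry (p q : nat) (x0 : 'cV[R]_q) (C : 'M[R]_(q, p)) i :
  continuous (fun r : 'rV[R]_p => (x0 + C *m r^T) i 0).
Proof.
rewrite (_ : (fun _ => _) = (fun r : 'rV[R]_p => x0 i 0 + \sum_k C i k * r 0 k)).
  apply: continuous_add; first exact: cst_continuous.
  apply: continuous_sum => k; apply: continuous_mul; first exact: cst_continuous.
  exact: coord_continuous.
by apply/funext => r; rewrite !mxE; congr (_ + _); apply: eq_bigr => k _; rewrite mxE.
Qed.

Lemma bounded_rV (p : nat) (S : set 'rV[R]_p) M :
  (forall r, S r -> forall i, `|r 0 i| <= M) -> bounded_set S.
Proof.
move=> SM; exists (Num.max M 0); split; first exact: num_real.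
move=> N MN r /SM rM; apply: le_trans (ltW MN).
rewrite /= [leLHS]/Num.norm /= mx_normrE.
apply: bigmax_le => [|[i j] _]; first by rewrite le_max lexx orbT.
by rewrite /= ord1 le_max rM.
Qed.

(** The orthogonality of the displacement turns a bound on the gap into a bound on the
    weighted sum of the variables. *)
Lemma gap_displace_sum P V z l d (z' := displace P V z l d) : null_basis (lo_A P) V ->
  \sum_i (px z i 0 * ps z' i 0 + ps z i 0 * px z' i 0) = gap z' + gap z.
Proof.
move=> nbV; apply/eqP; rewrite -subr_eq0; apply/eqP.
transitivity (- \sum_i (V *m l) i 0 * (- ((lo_A P)^T *m d)) i 0); last first.
  by rewrite displacement_orthogonal// oppr0.
rewrite -sumrN !gapE -big_split -sumrB /=; apply: eq_bigr => i _.
rewrite [px z' i 0]mxE [ps z' i 0]mxE; ring.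
Qed.

(** The feasible points reached by displacements from [z0] are parametrised by [r], the
    right-hand side of the Newton system at [z0]. In this coordinate,
    [r_i = x0_i (s_i - s0_i) + s0_i (x_i - x0_i)] is bounded by the weighted sum of the
    variables, so that the set of maximisation is compact. Any displacement of the
    maximiser is itself of this form. *)
Lemma barrier_maximizer P V z0 K : (0 < n)%N -> null_basis (lo_A P) V ->
    interior_feasible P z0 -> gap z0 <= K ->
  exists z, [/\ feasible P z, gap z <= K, barrier K z0 <= barrier K z
    & forall l d (z' := displace P V z l d),
        feasible P z' -> gap z' <= K -> barrier K z' <= barrier K z].
Proof.
move=> n0 nbV zI gapK; have [zF x0 s0] := zI.
have /row_freeP[B MB] : row_free (newton_mx P V z0).
  by rewrite /row_free (newton_mx_rank nbV zI).
pose Z (r : 'rV[R]_n) := displace P V z0 (dsubmx (B *m r^T)) (usubmx (B *m r^T)).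
have xcont i : continuous (fun r => px (Z r) i 0).
  rewrite (_ : (fun _ => _) = fun r : 'rV[R]_n => (px z0 + (V *m dsubmx B) *m r^T) i 0).
    exact: continuous_affine_entry.
  by apply/funext => r; rewrite /= -mul_dsub_mx mulmxA.
have scont i : continuous (fun r => ps (Z r) i 0).
  rewrite (_ : (fun _ => _) =
      fun r : 'rV[R]_n => (ps z0 + (- ((lo_A P)^T *m usubmx B)) *m r^T) i 0).
    exact: continuous_affine_entry.
  by apply/funext => r; rewrite /= -mul_usub_mx mulmxA mulNmx.
have gcont : continuous (fun r => gap (Z r)).
  under eq_fun do rewrite gapE.
  by apply: continuous_sum => i; apply: continuous_mul; [exact: xcont | exact: scont].
have bcont : continuous (fun r => barrier K (Z r)).
  apply: continuous_mul.
    by apply: continuous_prod => i; apply: continuous_mul; [exact: xcont | exact: scont].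
  move=> r; apply: (@continuousB _ _ _ (fun=> K)); first exact: cst_continuous.
  exact: gcont.
have Z0 : Z 0 = z0.
  have d0 : dsubmx (0 : 'cV[R]_(m + (n - m))) = 0.
    by apply/matrixP => i j; rewrite [LHS]mxE !mxE.
  have u0 : usubmx (0 : 'cV[R]_(m + (n - m))) = 0.
    by apply/matrixP => i j; rewrite [LHS]mxE !mxE.
  rewrite /Z trmx0 mulmx0 d0 u0 /displace !mulmx0 !addr0 subr0.
  by case: (z0).
pose S : set 'rV[R]_n := [set r | feasible P (Z r) /\ gap (Z r) <= K]%classic.
have S0 : S 0 by rewrite /S /= Z0; split=> //; exact: interior_feasibleW.
have S_closed : closed S.
  rewrite (_ : S = (\bigcap_(i in setT) ([set r | 0 <= px (Z r) i 0] `&`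
      [set r | 0 <= ps (Z r) i 0]) `&` [set r | gap (Z r) <= K])%classic); last first.
    apply/seteqP; split=> r /=.
      by move=> [[_ xr sr] gr]; split=> // i _; split; [exact: xr | exact: sr].
    move=> [xs gr]; split=> //; split; first exact: displace_eq_feasible.
      by move=> i; case: (xs i I).
    by move=> i; case: (xs i I).
  apply: closedI; last first.
    apply: (@preimage_closed _ _ (fun r => gap (Z r)) [set y | y <= K]%classic).
      by move=> r _; exact: gcont.
    exact: closed_le.
  apply: closed_bigI => i _; apply: closedI.
    apply: (@preimage_closed _ _ (fun r => px (Z r) i 0) [set y | 0 <= y]%classic).
      by move=> r _; exact: xcont.
    exact: closed_ge.
  apply: (@preimage_closed _ _ (fun r => ps (Z r) i 0) [set y | 0 <= y]%classic).
    by move=> r _; exact: scont.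
  exact: closed_ge.
have S_bounded : bounded_set S.
  apply: (@bounded_rV _ _ (K + 3%:R * gap z0)) => r [[_ xr sr] gr] i.
  have rE : r 0 i = px z0 i 0 * (ps (Z r) i 0 - ps z0 i 0)
                  + ps z0 i 0 * (px (Z r) i 0 - px z0 i 0).
    transitivity ((newton_mx P V z0 *m (B *m r^T)) i 0).
      by rewrite mulmxA MB mul1mx mxE.
    rewrite -[B *m r^T]vsubmxK newton_mxE.
    by rewrite [ps (Z r) i 0]mxE [px (Z r) i 0]mxE ![_ + _ - _]addrAC !subrr !add0r.
  have p_le : px z0 i 0 * ps z0 i 0 <= gap z0.
    rewrite gapE (bigD1 i)//= lerDl sumr_ge0// => j _.
    by rewrite mulr_ge0 ?ltW.
  have := gap_displace_sum z0 (dsubmx (B *m r^T)) (usubmx (B *m r^T)) nbV.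
  rewrite -/(Z r) (bigD1 i)//=.
  have : 0 <= \sum_(j < n | j != i) (px z0 j 0 * ps (Z r) j 0 + ps z0 j 0 * px (Z r) j 0).
    by apply: sumr_ge0 => j _; rewrite addr_ge0// mulr_ge0// ltW.
  have xs0 : 0 <= px z0 i 0 * ps (Z r) i 0 by rewrite mulr_ge0// ltW.
  have sx0 : 0 <= ps z0 i 0 * px (Z r) i 0 by rewrite mulr_ge0// ltW.
  have xx0 : 0 <= px z0 i 0 * ps z0 i 0 by rewrite mulr_ge0// ltW.
  have g0 : 0 <= gap z0 := ltW (gap_gt0 n0 zI).
  by rewrite ler_norml rE; move: gr; lra.
have [||r rS rmax] :=
    compact_EVT_max (f := fun r => barrier K (Z r)) (A := S) _
      (bounded_closed_compact S_bounded S_closed).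
- by exists 0.
- exact: continuous_subspaceT.
have [rF rK] : S r := set_mem rS.
exists (Z r); split=> //.
  by rewrite -[X in barrier K X]Z0 rmax// inE.
move=> l d; cbv zeta => z'F z'K.
pose w := B *m r^T + col_mx d l.
have wE : B *m ((newton_mx P V z0 *m w)^T)^T = w.
  apply/eqP; rewrite -subr_eq0; apply/eqP; apply: (newton_mx_inj nbV zI).
  by rewrite trmxK mulmxBr mulmxA MB mul1mx subrr.
have ZE : Z (newton_mx P V z0 *m w)^T = displace P V (Z r) l d.
  rewrite /Z wE /w -[B *m r^T]vsubmxK add_col_mx !col_mxKu !col_mxKd.
  by rewrite /displace /= !mulmxDr opprD !addrA.
by rewrite -ZE; apply: rmax; rewrite inE /S /= ZE.
Qed.

(** Along the Newton direction from the maximiser to the products [nu = K - gap], the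
    product [x_i s_i] has derivative [nu - p_i], and the gap is affine with slope
    [\sum_i (nu - p_i)]. The derivative of the barrier at the maximiser is then
    [\prod_i p_i * \sum_i (nu - p_i) ^ 2 / p_i], and it is zero. Hence [p_i = nu] for all
    [i], and [nu] is the duality measure. *)
Lemma central_point_exists P V z0 : (0 < n)%N -> null_basis (lo_A P) V ->
    interior_feasible P z0 ->
  exists2 z, interior_feasible P z & forall i, px z i 0 * ps z i 0 = mu z.
Proof.
move=> n0 nbV zI; pose K := gap z0 + 1.
have [|z [[zF x_ge0 s_ge0] zK z0_le zmax]] := barrier_maximizer (K := K) n0 nbV zI.
  by rewrite lerDl.
have z0_gt0 : 0 < barrier K z0.
  rewrite /barrier mulr_gt0 ?subr_gt0 ?ltrDl// prodr_gt0// => i _.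
  by have [_ x0 s0] := zI; rewrite mulr_gt0.
have b_neq0 : barrier K z != 0 by rewrite gt_eqF// (lt_le_trans z0_gt0).
move: (b_neq0); rewrite mulf_eq0 negb_or subr_eq0 => /andP[prod_neq0 K_neq].
have p_neq0 i : px z i 0 * ps z i 0 != 0 by have /prodf_neq0 := prod_neq0; apply.
have x_gt0 i : 0 < px z i 0.
  by have := p_neq0 i; rewrite mulf_eq0 negb_or lt_def x_ge0 => /andP[-> _].
have s_gt0 i : 0 < ps z i 0.
  by have := p_neq0 i; rewrite mulf_eq0 negb_or lt_def s_ge0 => /andP[_ ->].
have {}zI : interior_feasible P z by [].
have gap_lt : gap z < K by rewrite lt_def K_neq.
(* the factor [K - gap z] turns out to be the duality measure of the maximiser *)
pose nu := K - gap z; have nu_gt0 : 0 < nu by rewrite subr_gt0.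
pose p i := px z i 0 * ps z i 0.
have p_gt0 i : 0 < p i by exact: mulr_gt0.
have [l [d Mw]] := newton_solvable (\col_i (nu - p i)) nbV zI.
pose dx i := (V *m l) i 0; pose ds i := (- ((lo_A P)^T *m d)) i 0.
have wE i : px z i 0 * ds i + ps z i 0 * dx i = nu - p i.
  by rewrite -newton_mxE Mw mxE.
pose c := \sum_i (nu - p i).
pose q i : {poly R} := (p i)%:P + (nu - p i) *: 'X + (dx i * ds i) *: 'X^2.
pose G : {poly R} := (\prod_i q i) * (nu%:P - c *: 'X).
pose Z t := displace P V z (t *: l) (t *: d).
have xE t i : px (Z t) i 0 = px z i 0 + t * dx i.
  by rewrite mxE -scalemxAr [X in _ + X]mxE.
have sE t i : ps (Z t) i 0 = ps z i 0 + t * ds i.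
  by rewrite mxE -scalemxAr -scalerN [X in _ + X]mxE.
have qE t i : (q i).[t] = px (Z t) i 0 * ps (Z t) i 0.
  by rewrite xE sE /q -wE !(hornerD, hornerZ, hornerC, hornerX, hornerXn) /p; ring.
have gapE_t t : gap (Z t) = gap z + t * c.
  rewrite gapE; under eq_bigr do rewrite -qE !(hornerD, hornerZ, hornerC, hornerX, hornerXn).
  rewrite !big_split /= -mulr_suml -[\sum_i (nu - p i)]/c -gapE.
  by rewrite -mulr_suml displacement_orthogonal// mul0r addr0 mulrC.
have GE t : G.[t] = barrier K (Z t).
  rewrite hornerM horner_prod /barrier gapE_t !hornerE opprD addrA mulrC [c * t]mulrC.
  by rewrite mulrC; congr (_ * _); apply: eq_bigr => i _; rewrite qE.
have [e1 e1_gt0 x_near] := affine_family_ge0 dx x_gt0.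
have [e2 e2_gt0 s_near] := affine_family_ge0 ds s_gt0.
have [e3 e3_gt0 g_near] := @affine_family_ge0 unit (fun=> nu) (fun=> - c) (fun=> nu_gt0).
have Z0E : Z 0 = z.
  rewrite /Z !scale0r /displace !mulmx0 !addr0 subr0; by case: (z).
have G'0 : G^`().[0] = 0.
  apply: (@poly_deriv_at_max G 0 (Num.min e1 (Num.min e2 e3))).
    by rewrite !lt_min e1_gt0 e2_gt0.
  move=> t; rewrite subr0 !lt_min => /and3P[t1 t2 t3].
  rewrite !GE Z0E; apply: zmax.
    split=> [|i|i]; first exact: displace_eq_feasible.
      by rewrite xE x_near.
    by rewrite sE s_near.
  by have := g_near t t3 tt; rewrite gapE_t /nu; lra.
have q0 i : (q i).[0] = p i by rewrite qE Z0E.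
have q'0 i : (q i)^`().[0] = nu - p i.
  by rewrite /q !poly.derivE !hornerE /=; ring.
have : \sum_i (nu - p i) ^+ 2 / p i = 0.
  have prod_q : (\prod_i q i).[0] != 0.
    by rewrite horner_prod; apply/prodf_neq0 => i _; rewrite q0 gt_eqF.
  apply: (mulfI prod_q); rewrite mulr0 -[RHS]G'0 /G derivM hornerD !hornerM.
  rewrite deriv_prod_horner; last by move=> i; rewrite q0 gt_eqF.
  rewrite !poly.derivE !hornerE /= -mulrA -mulrDr; congr (_ * _).
  rewrite mulr_suml /c -sumrN -big_split /=; apply: eq_bigr => i _.
  by rewrite q0 q'0; field; rewrite gt_eqF.
move=> /eqP; rewrite psumr_eq0 => [|i _]; last by rewrite divr_ge0 ?sqr_ge0// ltW.
move=> /allP pnu.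
have pE i : p i = nu.
  have := pnu i (mem_index_enum _).
  by rewrite mulf_eq0 invr_eq0 (gt_eqF (p_gt0 i)) orbF sqrf_eq0 subr_eq0 => /eqP.
exists z => // i; rewrite -/(p i) pE /mu gapE.
under eq_bigr do rewrite -/(p _) pE.
by rewrite sumr_const card_ord -[nu *+ n]mulr_natl mulrC mulKf// pnatr_eq0 -lt0n.
Qed.

Lemma ipm_input_exists sol P : \rank (lo_A P) = m ->
    (exists z0, interior_feasible P z0) -> exists V z0, ipm_input sol P V z0.
Proof.
move=> rkA [z0 z0I]; have [V nbV] := null_basis_exists rkA.
have [n0|n_gt0] := posnP n.
  have n0R : n%:R = 0 :> R by rewrite n0.
  exists V, z0; split=> //; split=> //; rewrite nbhd_normE.
  rewrite (_ : \col_i _ = 0) ?norm2_0; first by rewrite /mu n0R invr0 !mulr0.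
  by apply/matrixP => -[i /= i_lt]; exfalso; move: i_lt; rewrite n0.
have [z zI zmu] := central_point_exists n_gt0 nbV z0I.
exists V, z; split=> //; split=> //; rewrite nbhd_normE.
rewrite (_ : \col_i _ = 0) ?norm2_0.
  by rewrite mulr_ge0 ?(ltW (mu_gt0 n_gt0 zI))//; case: sol; rewrite divr_ge0.
by apply/matrixP => i j; rewrite !mxE zmu subrr.
Qed.

End CentralPoint.

(** * Iterative refinement *)

Section Refinement.
Variables (R : realType) (m n : nat).
Implicit Types (P : lo_problem R m n) (z : pdpoint R m n) (sol : solver).

Lemma call_succeeds_interior sol P zeta : 0 < zeta -> \rank (lo_A P) = m ->
  (exists z0, interior_feasible P z0) -> call_succeeds sol P zeta.
Proof.
move=> zeta0 rkA z0I; split; first exact: ipm_input_exists.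
by move=> V z0 [nbV z0_near]; apply: ipm_terminates_nbhd.
Qed.

Lemma call_succeeds_output sol P zeta :
  call_succeeds sol P zeta -> exists z, call_output sol P zeta z.
Proof.
move=> [[V [z0 z0V]] /(_ V z0 z0V)/ipm_terminates_run[z z0z]].
by exists z, V, z0.
Qed.

Lemma call_output_optimal sol P zeta z : call_output sol P zeta z -> optimal P zeta z.
Proof. by move=> [V [z0 [_ /ipm_run_optimal]]]. Qed.

Lemma call_output_interior sol P zeta z : (0 < n)%N ->
  call_output sol P zeta z -> interior_feasible P z.
Proof. by move=> n0 [V [z0 [[nbV z0_near] /ipm_run_nbhd[]]]]. Qed.

Lemma refining_interior P z a : 0 < a -> interior_feasible P z ->
  exists z0, interior_feasible (refining P z a) z0.
Proof.
move=> a0 [[xF _] x0 s0]; exists (Point (a *: px z) 0 (a *: ps z)).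
split=> [|i|i] /=; [|by rewrite mxE mulr_gt0|by rewrite mxE mulr_gt0].
by split; rewrite /= -?scalemxAr ?xF// mulmx0 add0r.
Qed.

(** The part [- a x] of the correction cancels [x], and feasibility of [zh] means that
    [ps zh = a s - A^T (py zh)], which is what the update of [y] makes of [s], up to [a]. *)
Lemma refine_scaled P z a zh : a != 0 -> eq_feasible P z ->
    eq_feasible (refining P z a) zh ->
  px (refine P z a zh) = a^-1 *: px zh /\ ps (refine P z a zh) = a^-1 *: ps zh.
Proof.
move=> a0 [_ sF] [_ /= shF]; split=> /=.
  by rewrite scalerBr scalerA mulVf// scale1r addrC subrK.
have -> : ps zh = a *: ps z - (lo_A P)^T *m py zh by rewrite -shF addrC addKr.
rewrite -sF mulmxDr -scalemxAr scalerBr scalerA mulVf// scale1r.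
by rewrite opprD addrA [_ + ps z]addrC addrK.
Qed.

Lemma refine_interior P z a zh : 0 < a -> interior_feasible P z ->
    interior_feasible (refining P z a) zh ->
  interior_feasible P (refine P z a zh)
  /\ gap (refine P z a zh) = gap zh / a ^+ 2.
Proof.
move=> a0 [zF x0 s0] [zhF xh0 sh0]; have a_neq0 := lt0r_neq0 a0.
have [xE sE] := refine_scaled a_neq0 zF zhF; split.
  split=> [|i|i].
  - split; last by rewrite /= addrC subrK.
    by rewrite xE -scalemxAr zhF.1 /= scalerA mulVf// scale1r.
  - by rewrite xE mxE mulr_gt0 ?invr_gt0.
  - by rewrite sE mxE mulr_gt0 ?invr_gt0.
rewrite !gapE mulr_suml; apply: eq_bigr => i _; rewrite xE sE !mxE.
by field.
Qed.

Lemma ir_iterate_dim0 sol P zeta zetahat k z : n = 0%N -> 0 < zeta ->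
  ir_iterate sol P zeta zetahat k z -> optimal P zeta z.
Proof.
move=> n0 zeta0; elim=> {k z} [z /call_output_optimal[[zF _ _] _]|//].
exact: optimal_dim0.
Qed.

(** Each refinement squares the gap, up to the factor [n zetahat < 1]: the refining
    problem is solved to gap [n zetahat], and its solution is scaled by the square of the
    current gap. *)
Lemma ir_iterate_gap sol P zeta zetahat k z : (0 < n)%N -> n%:R * zetahat < 1 ->
    ir_iterate sol P zeta zetahat k z ->
  interior_feasible P z /\ gap z <= (n%:R * zetahat) ^+ (2 ^ k.-1).
Proof.
move=> n0 q1.
have gap_output P' z' : call_output sol P' zetahat z' -> gap z' <= n%:R * zetahat.
  move=> /call_output_optimal[_ z'_mu].
  by rewrite gap_mu// ler_pM2l ?ltr0n.
elim=> {k z} [z zO|k z zh zk [zI z_gap] _ zhO].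
  by split; [exact: call_output_interior zO | rewrite expr1; exact: gap_output zO].
have z_gt0 := gap_gt0 n0 zI.
have a_gt0 : 0 < nabla z by rewrite invr_gt0.
have [rI r_gap] := refine_interior a_gt0 zI (call_output_interior n0 zhO).
split=> //; rewrite r_gap.
case: k zk z_gap => [zk|k _ z_gap]; first by inversion zk.
have zh_le1 : gap zh <= 1 := le_trans (gap_output _ _ zhO) (ltW q1).
rewrite /= expnSr exprM /nabla exprVn invrK.
apply: (@le_trans _ _ (gap z ^+ 2)); first by rewrite ler_piMl// sqr_ge0.
by rewrite ler_sqr ?nnegrE ?(ltW z_gt0)// (le_trans (ltW z_gt0)).
Qed.

Lemma not_optimal_gap P zeta z : (0 < n)%N -> interior_feasible P z ->
  ~ optimal P zeta z -> zeta < gap z.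
Proof.
move=> n0 zI zNO; rewrite ltNge; apply/negP => z_gap; apply: zNO.
split; first exact: interior_feasibleW.
apply: le_trans z_gap; rewrite ler_pdivrMr ?ltr0n//.
by rewrite ler_peMr ?(ltW (gap_gt0 n0 zI))// ler1n.
Qed.

End Refinement.

(** * Counting the calls *)

Section CallCount.
Variable R : realType.

(** The maximum is over finitely many [n], those below [1 / zetahat]. *)
Lemma uniform_gap_bound (zetahat : R) : 0 < zetahat -> zetahat < 1 ->
  exists Q : R, [/\ 0 < Q, Q < 1 & forall n, n%:R * zetahat < 1 -> n%:R * zetahat <= Q].
Proof.
move=> z0 z1.
pose N := Num.bound zetahat^-1.
exists (\big[Num.max/zetahat]_(n < N | n%:R * zetahat < 1) (n%:R * zetahat)); split.
- by apply: lt_le_trans z0 _; exact: bigmax_ge_id.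
- by apply: bigmax_lt.
move=> n nz.
have nN : (n < N)%N.
  rewrite -(ltr_nat R); apply: lt_trans (archi_boundP _); last by rewrite invr_ge0 ltW.
  by rewrite -[ltRHS]mul1r ltr_pdivlMr.
exact: (@le_bigmax_cond _ _ _ _ (Ordinal nN) _ (fun i : 'I_N => i%:R * zetahat)).
Qed.

Lemma iterated_square_count (zeta Q : R) k : 0 < zeta -> zeta < 1 -> 0 < Q -> Q < 1 ->
    zeta < Q ^+ (2 ^ k) ->
  k%:R * ln 2 + ln (ln (1 / Q)) < ln (ln (1 / zeta)).
Proof.
move=> z0 z1 Q0 Q1 zQ.
have lnV (x : R) : 0 < x -> ln (1 / x) = - ln x by move=> x0; rewrite div1r lnV.
have lnQ : 0 < ln (1 / Q) by rewrite lnV// oppr_gt0 ln_lt0// Q0.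
have ln2k : k%:R * ln 2 = ln ((2 : R) ^+ k) by rewrite lnXn// mulr_natl.
have p2k : (0 : R) < 2 ^+ k by rewrite exprn_gt0.
rewrite ln2k -lnM// ltr_ln ?posrE ?mulr_gt0//; last first.
  by rewrite lnV// oppr_gt0 ln_lt0// z0.
rewrite !lnV// mulrN ltrN2 -natrX mulr_natl -lnXn//.
by rewrite ltr_ln ?posrE ?exprn_gt0.
Qed.

End CallCount.

Theorem theorem6p2 (R : realType) (zetahat : R)
    (zetahat_gt0 : 0 < zetahat) (zetahat_lt1 : zetahat < 1)
    (loglog_neq0 : ln (ln (1 / zetahat)) != 0) :
  exists C : R,
    forall (sol : solver) (m n : nat) (P : lo_problem R m n) (zeta : R),
      \rank (lo_A P) = m ->
      (exists z0 : pdpoint R m n, interior_feasible P z0) ->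
      n%:R * zetahat < 1 ->
      0 < zeta -> zeta < zetahat ->
      ir_produces_optimal sol P zeta zetahat (C * call_bound zeta zetahat).
Proof.
have [Q [Q_gt0 Q_lt1 leQ]] := uniform_gap_bound zetahat_gt0 zetahat_lt1.
set l := ln (ln (1 / zetahat)) in loglog_neq0.
pose D := ln (ln (1 / Q)).
have ln2_gt0 : 0 < ln 2 :> R by rewrite ln_gt0// ltr1n.
(* The last iterate to be refined has a number [k + 1] with
   [k * ln 2 < ln (ln (1 / zeta)) - D], and one more call follows, so that [k + 2] calls
   are made; the last summand makes up for the division by [l]. *)
exists (2%:R + `|D| / ln 2 + `|l| / ln 2).
move=> sol m n P zeta rkA z0I q1 zeta_gt0 zeta_lt.
have zeta_lt1 := lt_trans zeta_lt zetahat_lt1.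
set L := ln (ln (1 / zeta)); set N := _ * call_bound _ _.
have N_ge : 2%:R + `|D| / ln 2 + `|L| / ln 2 <= N.
  have cb1 : 1 <= call_bound zeta zetahat by rewrite le_max lexx.
  have cbL : `|L / l| <= call_bound zeta zetahat by rewrite le_max lexx orbT.
  have D_ge0 : 0 <= 2%:R + `|D| / ln 2.
    by rewrite addr_ge0// divr_ge0// ltW.
  rewrite /N mulrDl lerD//; first by rewrite ler_peMr.
  have -> : `|L| / ln 2 = `|l| / ln 2 * `|L / l|.
    by rewrite normf_div; field; rewrite normr_eq0 loglog_neq0 gt_eqF.
  by rewrite ler_wpM2l// divr_ge0// ltW.
have n_gt0 k z : ir_iterate sol P zeta zetahat k z -> ~ optimal P zeta z -> (0 < n)%N.
  move=> zk zNO; rewrite lt0n; apply/eqP => n0; apply: zNO.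
  exact: ir_iterate_dim0 zk.
have count k z : ir_iterate sol P zeta zetahat k z -> k%:R <= N.
  case=> {k z} [z _|k z zh zk zNO _].
    apply: le_trans N_ge; rewrite -addrA (@le_trans _ _ 2%:R) ?ler1n// lerDl.
    by rewrite addr_ge0// divr_ge0// ltW.
  have n0 := n_gt0 k z zk zNO.
  have [zI z_gap] := ir_iterate_gap n0 q1 zk.
  have k_gt0 : (0 < k)%N by case: (zk).
  have zetaQ : zeta < Q ^+ (2 ^ k.-1).
    apply: lt_le_trans (not_optimal_gap n0 zI zNO) _; apply: le_trans z_gap _.
    by rewrite lerXn2r ?nnegrE ?mulr_ge0 ?(ltW Q_gt0) ?(ltW zetahat_gt0)// leQ.
  have := iterated_square_count zeta_gt0 zeta_lt1 Q_gt0 Q_lt1 zetaQ.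
  rewrite -/D -/L => kL; apply: le_trans N_ge.
  have -> : k.+1%:R = 2%:R + k.-1%:R :> R by rewrite -natrD add2n prednK.
  rewrite -[leRHS]addrA lerD2l.
  rewrite -mulrDl ler_pdivlMr//.
  have := ler_norm L; have := ler_norm (- D); rewrite normrN.
  by move: kL; lra.
have next k z : ir_iterate sol P zeta zetahat k z -> ~ optimal P zeta z ->
    [/\ feasible P z, 1 < nabla z & call_succeeds sol (refining P z (nabla z)) zetahat].
  move=> zk zNO; have n0 := n_gt0 k z zk zNO.
  have [zI z_gap] := ir_iterate_gap n0 q1 zk; have gap0 := gap_gt0 n0 zI.
  split; first exact: interior_feasibleW.
    rewrite invf_gt1//; apply: le_lt_trans z_gap _.
    by rewrite exprn_ilt1 ?mulr_ge0 ?(ltW zetahat_gt0)// -lt0n expn_gt0.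
  apply: call_succeeds_interior => //; apply: refining_interior => //.
  by rewrite invr_gt0.
have first : call_succeeds sol P zetahat by exact: call_succeeds_interior.
split=> //.
apply: contrapT => no_optimal.
have iterates k : exists z, ir_iterate sol P zeta zetahat k.+1 z.
  elim: k => [|k [z zk]].
    by have [z zO] := call_succeeds_output first; exists z; exact: Ir_first.
  have zNO : ~ optimal P zeta z by move=> zO; apply: no_optimal; exists k.+1, z.
  have [_ _ /call_succeeds_output[zh zhO]] := next _ _ zk zNO.
  by exists (refine P z (nabla z) zh); exact: Ir_next zhO.
have [z /count] := iterates (Num.bound N).
apply/negP; rewrite -ltNge; apply: lt_le_trans (archi_boundP _) _.
  by apply: le_trans N_ge; rewrite !addr_ge0// divr_ge0// ltW.
by rewrite ler_nat.
Qed.
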